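(* For every $n\in\mathbb{N}$ (i.e. every positive integer $n$), $W_{c}(K_{2n+1})\geq 3n$.
   Context: $K_{m}$ is the complete graph on $m$ vertices. For a finite simple graph $G$ and a positive integer $t$, an interval cyclic $t$-coloring of $G$ is a proper edge-coloring of $G$ with colors $1,\ldots,t$ such that all $t$ colors are used and, for each vertex $v$, the edges incident to $v$ are colored by $d_{G}(v)$ consecutive colors modulo $t$ (i.e. consecutive in the cyclic order $1,2,\ldots,t,1$), where $d_G(v)$ is the degree of $v$. For a graph $G$ having an interval cyclic $t$-coloring for some positive integer $t$, $W_{c}(G)$ is the greatest such $t$. (All complete graphs $K_{2n+1}$, $n\ge 1$, have such a coloring.) *)

(* Defs.v *)
From mathcomp Require Import all_boot.

Set Implicit Arguments.
Unset Strict Implicit.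
Unset Printing Implicit Defensive.

Record sgraph := SGraph {
  vertex :> finType;
  adj : rel vertex;
  adj_sym : symmetric adj;
  adj_irrefl : irreflexive adj
}.

Definition edges (G : sgraph) : {set {set G}} :=
  [set [set p.1; p.2] | p in [pred p : G * G | adj p.1 p.2]].

Definition degree (G : sgraph) (v : G) : nat := #|[set w : G | adj v w]|.

(* Only the values of c on [edges G] are constrained. *)
Definition proper_edge_coloring (G : sgraph) (c : {set G} -> nat) : Prop :=
  forall e f : {set G}, e \in edges G -> f \in edges G ->
    e != f -> e :&: f != set0 -> c e <> c f.

Definition color_at (G : sgraph) (c : {set G} -> nat) (v : G) (i : nat) : Prop :=
  exists e : {set G}, [/\ e \in edges G, v \in e & c e = i].

(* Among the colors 1, ..., t, exactly d consecutive ones, starting from s, in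
   the cyclic order 1, 2, ..., t, 1. *)
Definition cyclic_interval (t s d i : nat) : Prop :=
  0 < i <= t /\ exists2 j, j < d & i = s + j %[mod t].

Definition interval_cyclic_coloring
    (G : sgraph) (t : nat) (c : {set G} -> nat) : Prop :=
  [/\ proper_edge_coloring c,
      forall e : {set G}, e \in edges G -> 0 < c e <= t,
      forall i, 0 < i <= t -> exists2 e : {set G}, e \in edges G & c e = i
    & forall v : G, exists2 s, 0 < s <= t &
        forall i, color_at c v i <-> cyclic_interval t s (degree v) i].

Definition interval_cyclic_colorable (G : sgraph) (t : nat) : Prop :=
  0 < t /\ exists c : {set G} -> nat, interval_cyclic_coloring t c.

(* W_c is a partial function of G, given here by its graph: [is_Wc G w] says
   that W_c(G) is defined and equal to w. *)
Definition is_Wc (G : sgraph) (w : nat) : Prop :=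
  interval_cyclic_colorable G w /\
  forall t, interval_cyclic_colorable G t -> t <= w.

Definition complete_adj (m : nat) : rel 'I_m := fun x y => x != y.

Lemma complete_adj_sym (m : nat) : symmetric (@complete_adj m).
Proof. by move=> x y; rewrite /complete_adj eq_sym. Qed.

Lemma complete_adj_irrefl (m : nat) : irreflexive (@complete_adj m).
Proof. by move=> x; rewrite /complete_adj eqxx. Qed.

Definition complete_graph (m : nat) : sgraph :=
  SGraph (@complete_adj_sym m) (@complete_adj_irrefl m).

(* Main.v *)
Require Import Defs.
From mathcomp Require Import all_boot.
From mathcomp Require Import zify.
From Stdlib Require Import Classical_Prop.

(** An interval cyclic 3n-coloring of K_(2n+1) is written down explicitly, on
    the vertices 0, ..., 2n.

    The vertices 0, ..., 2n-1 span a K_2n, which has the round-robin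
    1-factorization with classes indexed by the residues k modulo 2n-1: the edge
    xy with 0 < x, y lies in the class k such that 2k = x + y, and the edge 0y
    in the class y.  For 1 <= k <= n-1 the k-th class preserves the set
    {0, ..., 2k-1}, so it contains no edge xy with x/2 < k <= y/2 (halves rounded
    down).  This is exactly what is needed to lift the residues to integers so
    that the edges of K_2n at x receive the 2n-1 colors from x/2 + 1 to
    x/2 + 2n-1.

    The edges from the last vertex 2n then extend each of these intervals by one
    color: at the bottom, by x/2 (read as 3n when x = 1), for x odd, and at the
    top, by x/2 + 2n, for x even.  The last vertex itself sees
    2n, ..., 3n, 1, ..., n-1, again a cyclic interval.

    Since the colors at a vertex are pairwise distinct, it suffices to see that
    they lie in a cyclic interval as long as the degree: by counting, they fill
    it ([spectrum_of_window]).  Finally W_c exists because the number of colors is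
    at most the number of edges ([colors_le_edges]). *)

Set Implicit Arguments.
Unset Strict Implicit.
Unset Printing Implicit Defensive.

Section Graphs.

Variable G : sgraph.

Lemma edge_in (x y : G) : adj x y -> [set x; y] \in edges G.
Proof. by move=> xy; apply/imsetP; exists (x, y). Qed.

Lemma edge_at (e : {set G}) (v : G) : e \in edges G -> v \in e ->
  exists2 w, adj v w & e = [set v; w].
Proof.
case/imsetP=> -[x y]; rewrite inE /= => xy -> /set2P[] ->; first by exists y.
by exists x; [rewrite adj_sym | rewrite setUC].
Qed.

(** The edge set {x, y} gets the value f x y; this is meaningful for a
    symmetric f. *)
Definition set_color (f : G -> G -> nat) (e : {set G}) : nat :=
  if [pick p : G * G | e == [set p.1; p.2]] is Some p then f p.1 p.2 else 0.

Lemma set_colorE (f : G -> G -> nat) (x y : G) :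
  (forall u v, f u v = f v u) -> set_color f [set x; y] = f x y.
Proof.
move=> fC; rewrite /set_color; case: pickP => [[a b] /= /eqP E|/(_ (x, y))];
  last by rewrite eqxx.
have [xE yE] : x \in [set a; b] /\ y \in [set a; b] by rewrite -E set21 set22.
have [aE bE] : a \in [set x; y] /\ b \in [set x; y] by rewrite E set21 set22.
case/set2P: aE E xE yE => ->; case/set2P: bE => -> // _.
- by move=> _ /set2P[] ->.
- by move=> /set2P[] ->.
Qed.

(** Counting: distinct colors lying in a cyclic interval of length the degree
    fill that interval. *)
Lemma spectrum_of_window (f : G -> G -> nat) (t s : nat) (v : G) :
  (forall x y, f x y = f y x) ->
  (forall w, adj v w -> cyclic_interval t s (degree v) (f v w)) ->
  (forall w w', adj v w -> adj v w' -> f v w = f v w' -> w = w') ->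
  forall i, color_at (set_color f) v i <-> cyclic_interval t s (degree v) i.
Proof.
move=> fC win inj i; split.
  by case=> e [eE ve <-]; have [w vw ->] := edge_at eE ve; rewrite set_colorE //; exact: win.
have mod_inj a b : 0 < a <= t -> 0 < b <= t -> a = b %[mod t] -> a = b.
  move=> /andP[a0 +] /andP[b0 +]; rewrite leq_eqVlt [b <= t]leq_eqVlt.
  move=> /orP[/eqP->|at_] /orP[/eqP->|bt] //.
  - by move=> E; move: b0; rewrite -(modn_small bt) -E modnn.
  - by move=> E; move: a0; rewrite -(modn_small at_) E modnn.
  - by rewrite !modn_small.
case=> it [j jd ij].
pose N := [set w : G | adj v w].
(* The set of offsets realized by the neighbours of v. *)
pose off w : 'I_(degree v) :=
  odflt (Ordinal jd) [pick k : 'I_(degree v) | f v w == s + k %[mod t]].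
have offP w : adj v w -> f v w = s + off w %[mod t].
  move=> vw; rewrite /off; case: pickP => [k /eqP //|none].
  have [_ [k kd E]] := win _ vw.
  by have := none (Ordinal kd); rewrite /= E eqxx.
have off_inj : {in N &, injective off}.
  move=> w w'; rewrite !inE => vw vw' E; apply: inj => //.
  apply: mod_inj; [by case: (win _ vw) | by case: (win _ vw') |].
  by rewrite offP // E -offP.
have offT : off @: N = setT.
  by apply/eqP; rewrite eqEcard subsetT cardsT card_ord card_in_imset //; exact: leqnn.
have := in_setT (Ordinal jd); rewrite -offT => /imsetP[w]; rewrite inE => vw E.
exists [set v; w]; split; [exact: edge_in | exact: set21 |].
rewrite set_colorE //; apply: mod_inj => //; first by case: (win _ vw).
by rewrite offP // -E ij.
Qed.

(** Every color is used, so sending each color to an edge of that color is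
    injective. *)
Lemma colors_le_edges (t : nat) :
  interval_cyclic_colorable G t -> t <= #|edges G|.
Proof.
case=> _ [c [_ _ used _]].
pose g (k : 'I_t) := odflt set0 [pick e in edges G | c e == k.+1].
have gP k : g k \in edges G /\ c (g k) = k.+1.
  rewrite /g; case: pickP => [e /andP[eE /eqP //]|none].
  have [e eE ce] := used k.+1 (ltn_ord k).
  by have := none e; rewrite /= eE ce eqxx.
have g_inj : injective g.
  by move=> k l E; apply/val_inj/succn_inj; rewrite -(gP k).2 E (gP l).2.
rewrite -[t in t <= _]card_ord -(card_codom g_inj).
by apply/subset_leq_card/subsetP => e /codomP[k ->]; case: (gP k).
Qed.

End Graphs.

Lemma exists_max (P : nat -> Prop) (m b : nat) :
  P m -> (forall t, P t -> t <= b) ->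
  exists w, [/\ P w, forall t, P t -> t <= w & m <= w].
Proof.
have [k] := ubnP (b - m); elim: k m => // k IH m bk Pm Pb.
have [[t [Pt mt]]|none] := classic (exists t, P t /\ m < t).
  have tb := Pb _ Pt; have [|w [Pw maxw tw]] := IH t _ Pt Pb; first by lia.
  by exists w; split=> //; lia.
exists m; split=> // t Pt; rewrite leqNgt; apply/negP => mt; apply: none.
by exists t.
Qed.

(** The color of the edge joining x < y in K_(2n+1). *)
Definition ordered_color (n x y : nat) : nat :=
  if y == 2 * n then
    if odd x then if x == 1 then 3 * n else x./2 else x./2 + 2 * n
  else if x == 0 then y
  else if odd (x + y) then (x + y + 2 * n - 1)./2 else (x + y)./2.

Definition pair_color (n x y : nat) : nat :=
  if x < y then ordered_color n x y else ordered_color n y x.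

(** The color at which the cyclic interval of x starts. *)
Definition window_start (n x : nat) : nat :=
  if x == 2 * n then 2 * n
  else if odd x then if x == 1 then 3 * n else x./2 else x./2 + 1.

Lemma pair_colorC (n x y : nat) : pair_color n x y = pair_color n y x.
Proof. by rewrite /pair_color; case: ltngtP => // ->. Qed.

Lemma pair_color_inj (n x y z : nat) :
  x <= 2 * n -> y <= 2 * n -> z <= 2 * n -> x != y -> x != z ->
  pair_color n x y = pair_color n x z -> y = z.
Proof.
rewrite /pair_color /ordered_color => hx hy hz xy xz.
by do !case: ifP; lia.
Qed.

Lemma pair_color_range (n x y : nat) :
  0 < n -> x <= 2 * n -> y <= 2 * n -> x != y -> 0 < pair_color n x y <= 3 * n.
Proof.
by rewrite /pair_color /ordered_color => *; do !case: ifP; lia.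
Qed.

Lemma window_start_range (n x : nat) :
  0 < n -> x <= 2 * n -> 0 < window_start n x <= 3 * n.
Proof. by rewrite /window_start => *; do !case: ifP; lia. Qed.

Lemma pair_color_window (n x y : nat) :
  0 < n -> x <= 2 * n -> y <= 2 * n -> x != y ->
  let s := window_start n x in let c := pair_color n x y in
  s <= c < s + 2 * n \/ s <= c + 3 * n < s + 2 * n.
Proof.
rewrite /pair_color /ordered_color /window_start /=  => *.
by do !case: ifP; lia.
Qed.

Lemma degree_complete (m : nat) (v : complete_graph m) : degree v = m.-1.
Proof.
rewrite /degree; have -> : [set w | adj v w] = ~: [set v].
  by apply/setP => w; rewrite !inE /= /complete_adj eq_sym.
by rewrite cardsC1 card_ord.
Qed.

Lemma complete_colorable (n : nat) :
  0 < n -> interval_cyclic_colorable (complete_graph (2 * n + 1)) (3 * n).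
Proof.
move=> n0; split; first by lia.
set G := complete_graph _.
pose f (x y : G) := pair_color n (x : 'I_ _) (y : 'I_ _).
have fC x y : f x y = f y x by exact: pair_colorC.
have le (x : G) : (x : 'I_ _) <= 2 * n.
  by rewrite -ltnS -[ltnRHS]addn1; exact: ltn_ord.
have deg (v : G) : degree v = 2 * n.
  by rewrite degree_complete addn1.
have inj (v w w' : G) : adj v w -> adj v w' -> f v w = f v w' -> w = w'.
  by move=> vw vw' /(pair_color_inj (le v) (le w) (le w') vw vw') /val_inj.
have win (v w : G) : adj v w ->
    cyclic_interval (3 * n) (window_start n (v : 'I_ _)) (degree v) (f v w).
  move=> vw; split; first exact: pair_color_range.
  rewrite deg; have /= := pair_color_window n0 (le v) (le w) vw.
  rewrite -/(f v w); set s := window_start _ _ => -[] sc.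
    by exists (f v w - s); [lia | congr modn; lia].
  exists (f v w + 3 * n - s); first by lia.
  by rewrite subnKC ?modnDr //; lia.
have spec (v : G) := spectrum_of_window fC (win v) (@inj v).
exists (set_color f); split.
- move=> e e' eE e'E ne /set0Pn[v /setIP[ve ve']].
  have [w vw ew] := edge_at eE ve; have [w' vw' ew'] := edge_at e'E ve'.
  rewrite {}ew {}ew' in ne *; rewrite !set_colorE // => /(inj _ _ _ vw vw') E.
  by rewrite E eqxx in ne.
- move=> e /imsetP[[x y]]; rewrite inE /= => xy ->.
  by rewrite set_colorE //; exact: pair_color_range.
- move=> i it.
  (* The vertices 1 and 2n start at 3n and 2n, so together they see all colors. *)
  have h1 : 1 < 2 * n + 1 by lia.
  have h2 : 2 * n < 2 * n + 1 by lia.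
  suff [v [e [eE _ ce]]] : exists v : G, color_at (set_color f) v i.
    by exists e.
  have [i2n|i2n] := ltnP i (2 * n).
    exists (Ordinal h1 : G); apply/spec; split=> //; exists i; first by rewrite deg.
    rewrite /window_start /=; have -> : (1 == 2 * n) = false by lia.
    by rewrite modnDl.
  exists (Ordinal h2 : G); apply/spec; split=> //; exists (i - 2 * n).
    by rewrite deg; lia.
  by rewrite /window_start /= eqxx subnKC.
- move=> v; exists (window_start n (v : 'I_ _)); first exact: window_start_range.
  exact: spec.
Qed.

Theorem theorem27 (n : nat) (hn : 0 < n) :
  exists w : nat, is_Wc (complete_graph (2 * n + 1)) w /\ 3 * n <= w.
Proof.
have [w [cw maxw le_w]] :=
  exists_max (complete_colorable hn) (@colors_le_edges _).
by exists w.
Qed.
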